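(* Let $D\in\mathbb N$, $(\gamma_n)_{n\in\mathbb N_0}\subseteq[0,\infty)$, $(\alpha_n)_{n\in\mathbb N_0}\subseteq[0,1]$, $(\beta_n)_{n\in\mathbb N_0}\subseteq[0,1]$, $\varepsilon\in(0,\infty)$ satisfy $\max\{\alpha_0,\beta_0\}<1$, let $(\Omega,\mathcal F,\mathbb P)$ be a probability space, for every $n\in\mathbb N_0$ let $\mathfrak G_n=(\mathfrak G_n^1,\dots,\mathfrak G_n^D)\colon\mathbb R^D\times\Omega\to\mathbb R^D$ be measurable, and let $\Theta=(\Theta^1,\dots,\Theta^D)$, $\mathbf m=(\mathbf m^1,\dots,\mathbf m^D)$, $\mathbb M=(\mathbb M^1,\dots,\mathbb M^D)\colon\mathbb N_0\times\Omega\to\mathbb R^D$ satisfy for all $n\in\mathbb N_0$, $i\in\{1,\dots,D\}$ that $\mathbf m_0=\mathbb M_0=0$, $$\mathbf m_{n+1}=\alpha_n\mathbf m_n+(1-\alpha_n)\mathfrak G_n(\Theta_n),\qquad\mathbb M_{n+1}^i=\beta_n\mathbb M_n^i+(1-\beta_n)|\mathfrak G_n^i(\Theta_n)|^2,$$ $$\Theta_{n+1}^i=\Theta_n^i-\gamma_n\Bigl(\varepsilon+\Bigl[\frac{\mathbb M_{n+1}^i}{1-\prod_{l=0}^n\beta_l}\Bigr]^{1/2}\Bigr)^{-1}\frac{\mathbf m_{n+1}^i}{1-\prod_{l=0}^n\alpha_l}.$$ Then there exist functions $\Phi_n=(\Phi_n^1,\dots,\Phi_n^D)\colon(\mathbb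 R^D)^{n+1}\to\mathbb R^D$, $n\in\mathbb N_0$, which satisfy for all $n\in\mathbb N_0$ that $$\Theta_{n+1}=\Theta_n-\Phi_n(\mathfrak G_0(\Theta_0),\mathfrak G_1(\Theta_1),\dots,\mathfrak G_n(\Theta_n))$$ and which satisfy for all $n\in\mathbb N_0$, $G=((G_{i,j})_{j\in\{1,\dots,D\}})_{i\in\{0,1,\dots,n\}}\in(\mathbb R^D)^{n+1}$, $j\in\{1,\dots,D\}$ with $\sum_{i=0}^n|G_{i,j}|=0$ that $\Phi_n^j(G)=0$.
   Context: $\mathfrak G_n(\Theta_n)$ denotes the function $\omega\mapsto\mathfrak G_n(\Theta_n(\omega),\omega)$. *)

(* Defs.v *)
From mathcomp Require Import all_boot all_order all_algebra.
From mathcomp Require Import all_classical all_reals all_analysis.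

Set Implicit Arguments.
Unset Strict Implicit.
Unset Printing Implicit Defensive.

Import Order.TTheory GRing.Theory Num.Theory.
Import numFieldNormedType.Exports.

Local Open Scope ring_scope.

(* The library puts no sigma-algebra on row vectors.  This is a copy of
   'rV[R]_D carrying the Borel sigma-algebra of its usual topology; it is
   convertible to 'rV[R]_D, so it only matters in measurability statements. *)
Definition borel_rV (R : realType) (D : nat) :=
  g_sigma_algebraType (@open 'rV[R]_D).

(* Main.v *)
Require Import Defs.
From mathcomp Require Import all_boot all_order all_algebra.
From mathcomp Require Import all_classical all_reals all_analysis.

Set Implicit Arguments.
Unset Strict Implicit.
Unset Printing Implicit Defensive.

Import Order.TTheory GRing.Theory Num.Theory.
Import numFieldNormedType.Exports.

Local Open Scope ring_scope.

(** Both moment recursions start at zero, so at each sample point and in each coordinate [m] and [M]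
    are exponential moving averages of the observed gradient coordinates and of their squares. They
    depend on [Theta] only through those gradients. Substituting them into the update of [Theta]
    gives a deterministic [Phi]. If a coordinate of all the gradients vanishes, so does its
    first-moment average, a factor of the step. [exp_avg_eq] and [eq_exp_avg0] carry these two
    arguments. *)

Section ExpMovingAverage.
Variable R : nzRingType.
Implicit Types a x u : nat -> R.

Fixpoint exp_avg a x n : R :=
  if n is k.+1 then a k * exp_avg a x k + (1 - a k) * x k else 0.

(** The recursion is required only below [n], since [exp_avg a x n] reads only [x 0], ...,
    [x (n - 1)]; a finite gradient history may thus be extended arbitrarily. *)
Lemma exp_avg_eq a x u n : u 0%N = 0 ->
  (forall k, (k < n)%N -> u k.+1 = a k * u k + (1 - a k) * x k) ->
  u n = exp_avg a x n.
Proof.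
move=> u0; elim: n => [|n IHn] uS //=.
by rewrite uS // IHn // => k ltkn; apply: uS; apply: ltnW.
Qed.

Lemma eq_exp_avg0 a x n :
  (forall k, (k < n)%N -> x k = 0) -> exp_avg a x n = 0.
Proof.
elim: n => [|n IHn] //= x0.
by rewrite x0 // IHn ?mulr0 ?addr0 // => k ltkn; apply: x0; apply: ltnW.
Qed.

End ExpMovingAverage.

Theorem lemma4p9 (R : realType) (D : nat) (D_gt0 : (0 < D)%N)
  (gamma alpha beta : nat -> R) (eps : R)
  (gamma_ge0 : forall n, 0 <= gamma n)
  (alpha01 : forall n, 0 <= alpha n <= 1)
  (beta01 : forall n, 0 <= beta n <= 1)
  (eps_gt0 : 0 < eps)
  (max_lt1 : Num.max (alpha 0%N) (beta 0%N) < 1)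
  (d : measure_display) (Omega : measurableType d)
  (P : probability Omega R)
  (G : nat -> 'rV[R]_D * Omega -> 'rV[R]_D)
  (mG : forall n, measurable_fun setT
     (G n : borel_rV R D * Omega -> borel_rV R D))
  (Theta m M : nat -> Omega -> 'rV[R]_D)
  (m0 : forall w, m 0%N w = 0)
  (M0 : forall w, M 0%N w = 0)
  (mS : forall n w,
     m n.+1 w = alpha n *: m n w + (1 - alpha n) *: G n (Theta n w, w))
  (MS : forall n w (i : 'I_D),
     M n.+1 w 0 i = beta n * M n w 0 i
                    + (1 - beta n) * `|G n (Theta n w, w) 0 i| ^+ 2)
  (ThetaS : forall n w (i : 'I_D),
     Theta n.+1 w 0 i = Theta n w 0 i
       - gamma n
         * (eps + Num.sqrt (M n.+1 w 0 i / (1 - \prod_(l < n.+1) beta l)))^-1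
         * (m n.+1 w 0 i / (1 - \prod_(l < n.+1) alpha l))) :
  exists Phi : forall n : nat, n.+1.-tuple 'rV[R]_D -> 'rV[R]_D,
    (forall n w,
       Theta n.+1 w =
         Theta n w - Phi n [tuple G i (Theta i w, w) | i < n.+1])
    /\
    (forall n (g : n.+1.-tuple 'rV[R]_D) (j : 'I_D),
       \sum_(i < n.+1) `|tnth g i 0 j| = 0 -> Phi n g 0 j = 0).
Proof.
(* Padding with the default 0 turns the history into a sequence on [nat]; averages taken at [n.+1]
   stop at index [n] and never reach the padding. *)
pose coord n (g : n.+1.-tuple 'rV[R]_D) j k : R := nth 0 g k 0 j.
pose Phi n (g : n.+1.-tuple 'rV[R]_D) : 'rV[R]_D := \row_j (gamma n
  * (eps + Num.sqrt (exp_avg beta (fun k => `|coord n g j k| ^+ 2) n.+1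
                     / (1 - \prod_(l < n.+1) beta l)))^-1
  * (exp_avg alpha (coord n g j) n.+1 / (1 - \prod_(l < n.+1) alpha l))).
exists Phi; split=> [n w | n g j sum0].
- apply/rowP => j; set g := mktuple _.
  have gE k : (k < n.+1)%N -> coord n g j k = G k (Theta k w, w) 0 j.
    by move=> ltkn; rewrite /coord (nth_mktuple _ 0 (Ordinal ltkn)).
  have mE : m n.+1 w 0 j = exp_avg alpha (coord n g j) n.+1.
    (* Fixing [w] and [j] makes the vector recursion scalar. *)
    apply: (exp_avg_eq (u := fun k => m k w 0 j)); first by rewrite m0 mxE.
    by move=> k ltkn; rewrite mS gE // !mxE.
  have ME : M n.+1 w 0 j = exp_avg beta (fun k => `|coord n g j k| ^+ 2) n.+1.
    apply: (exp_avg_eq (u := fun k => M k w 0 j)); first by rewrite M0 mxE.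
    by move=> k ltkn; rewrite MS gE.
  by rewrite ThetaS mE ME !mxE.
- have g0 k : (k < n.+1)%N -> coord n g j k = 0.
    move=> ltkn; apply: normr0_eq0.
    (* A zero sum of nonnegative terms has only zero terms. *)
    have := psumr_eq0P (fun i _ => normr_ge0 _) sum0 => /(_ (Ordinal ltkn) isT).
    by rewrite /coord (tnth_nth 0) => ->.
  by rewrite mxE (eq_exp_avg0 _ g0) mul0r mulr0.
Qed.
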